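(* Let $K$ be a field and let $f_1,\ldots,f_k\in K[[x_1,\ldots,x_n]]$ be finitely many nonzero formal power series with assigned scopes, i.e. integers $s_1,\ldots,s_k$ with $0\leq s_i\leq n$. Choose a monomial order $<$ on $\mathbb{N}^n$. Let $x^{\alpha_i}=\mathrm{in}(f_i)$ be the initial monomial of $f_i$ with respect to $<$, set $$A=\bigcup_{i=1}^k\bigl(\alpha_i+(\mathbb{N}^{s_i}\times 0^{n-s_i})\bigr)\subset\mathbb{N}^n,\qquad B=\mathbb{N}^n\setminus A,$$ and let $K[[x]]^B$ be the space of power series whose expansions involve only monomials with exponent in $B$. Then every power series $f\in K[[x_1,\ldots,x_n]]$ admits an echelon power series division by $f_1,\ldots,f_k$ with respect to $<$; that is, there exist $a_i\in K[[x_1,\ldots,x_{s_i}]]$ for $i=1,\ldots,k$ and $b\in K[[x]]^B$ such that $$f=\sum_{i=1}^k a_if_i+b$$ and $$\mathrm{in}(f-b)=\min\{\mathrm{in}(a_i)\cdot\mathrm{in}(f_i):\ i=1,\ldots,k\},$$ where the minimum is taken with respect to the ordering of monomials induced by $<$.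
   Context: Here $\mathbb{N}=\{0,1,2,\ldots\}$ and $x=(x_1,\ldots,x_n)$. A monomial order on $\mathbb{N}^n$ is a total ordering compatible with addition and having $0$ as its smallest element; it induces an ordering on monomials $x^\alpha$, $\alpha\in\mathbb{N}^n$. For a nonzero power series $f$, the initial monomial $\mathrm{in}(f)$ is the smallest monomial with respect to this order appearing with nonzero coefficient in the expansion of $f$ (taken with coefficient $1$). One sets $\mathrm{in}(0)=0$. In the minimum, indices $i$ with $a_i=0$ are disregarded (equivalently, $0$ is regarded as larger than every monomial); if all $a_i$ are $0$, the minimum is $0$, so that the condition says $f=b$. For $s=0$, $K[[x_1,\ldots,x_s]]=K$. The set $\mathbb{N}^{s}\times 0^{n-s}$ consists of the exponent vectors whose last $n-s$ entries vanish. *)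

(* Defs.v *)
From HB Require Import structures.
From mathcomp Require Import all_boot all_order all_algebra.
From mathcomp Require Import boolp.
From mathcomp Require Import mpoly.

Set Implicit Arguments.
Unset Strict Implicit.
Unset Printing Implicit Defensive.

Import GRing.Theory.
Local Open Scope ring_scope.

Definition mpseries (n : nat) (R : Type) := 'X_{1..n} -> R.

Notation "{ 'mps' R [ n ] }" := (mpseries n R)
  (at level 0, R at level 2, n at level 2, format "{ 'mps'  R [ n ] }").

HB.instance Definition _ (n : nat) (R : eqType) :=
  gen_eqMixin (mpseries n R).
HB.instance Definition _ (n : nat) (R : choiceType) :=
  gen_choiceMixin (mpseries n R).

Section PowerSeriesRing.
Context (n : nat) (R : comNzRingType).
Implicit Types f g h : {mps R[n]}.

Definition mps_zero : {mps R[n]} := fun _ => 0.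
Definition mps_one : {mps R[n]} := fun m => (m == 0%MM)%:R.
Definition mps_opp f : {mps R[n]} := fun m => - f m.
Definition mps_add f g : {mps R[n]} := fun m => f m + g m.

(* Cauchy product. As for {mpoly R[n]}, the finite set of decompositions
   m = k.1 + k.2 is carved out of pairs of exponents of bounded degree. *)
Definition mps_mul f g : {mps R[n]} := fun m =>
  \sum_(k : 'X_{1..n < (mdeg m).+1, (mdeg m).+1} | m == (k.1 + k.2)%MM)
     f k.1 * g k.2.

Lemma mps_addA : associative mps_add.
Proof. by move=> f g h; apply/funext => m; apply: addrA. Qed.

Lemma mps_addC : commutative mps_add.
Proof. by move=> f g; apply/funext => m; apply: addrC. Qed.

Lemma mps_add0 : left_id mps_zero mps_add.
Proof. by move=> f; apply/funext => m; apply: add0r. Qed.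

Lemma mps_addN : left_inverse mps_zero mps_opp mps_add.
Proof. by move=> f; apply/funext => m; apply: addNr. Qed.

HB.instance Definition _ :=
  GRing.isZmodule.Build {mps R[n]} mps_addA mps_addC mps_add0 mps_addN.

Definition mps_trunc (d : nat) f : {mpoly R[n]} :=
  \sum_(m : 'X_{1..n < d}) f m *: 'X_[m].

Definition mps_approx (d : nat) (p : {mpoly R[n]}) f :=
  forall m : 'X_{1..n}, (mdeg m < d)%N -> p@_m = f m.

Lemma mps_truncP d f : mps_approx d (mps_trunc d f) f.
Proof. by move=> m lt_md; rewrite mcoeff_mpoly. Qed.

Lemma mps_approxM d p q f g :
  mps_approx d p f -> mps_approx d q g -> mps_approx d (p * q) (mps_mul f g).
Proof.
move=> pf qg m lt_md; rewrite (mcoeff_poly_mul _ _ (ltnSn _)) /mps_mul.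
apply: eq_bigr => k _; rewrite pf ?qg //.
- exact: leq_trans (bmdeg _) lt_md.
- exact: leq_trans (bmdeg _) lt_md.
Qed.

Lemma mps_approxD d p q f g :
  mps_approx d p f -> mps_approx d q g -> mps_approx d (p + q) (f + g).
Proof. by move=> pf qg m lt_md; rewrite mcoeffD pf ?qg. Qed.

Lemma mps_approx1 d : mps_approx d 1 mps_one.
Proof. by move=> m _; rewrite mcoeff1 /mps_one eq_sym. Qed.

Lemma mps_approx_inj f g :
  (forall d, exists2 p, mps_approx d p f & mps_approx d p g) -> f = g.
Proof.
move=> fg; apply/funext => m; have [p pf pg] := fg (mdeg m).+1.
by rewrite -pf ?pg.
Qed.

Lemma mps_mulA : associative mps_mul.
Proof.
move=> f g h; apply: mps_approx_inj => d.
have [[Tf Tg] Th] := (@mps_truncP d f, @mps_truncP d g,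
                    @mps_truncP d h).
exists (mps_trunc d f * (mps_trunc d g * mps_trunc d h)).
  exact: mps_approxM Tf (mps_approxM Tg Th).
by rewrite mulrA; exact: mps_approxM (mps_approxM Tf Tg) Th.
Qed.

Lemma mps_mulC : commutative mps_mul.
Proof.
move=> f g; apply: mps_approx_inj => d.
have [Tf Tg] := (@mps_truncP d f, @mps_truncP d g).
exists (mps_trunc d f * mps_trunc d g); first exact: mps_approxM.
by rewrite mulrC; exact: mps_approxM.
Qed.

Lemma mps_mul1 : left_id mps_one mps_mul.
Proof.
move=> f; apply: mps_approx_inj => d.
have Tf := @mps_truncP d f.
exists (1 * mps_trunc d f); first exact: mps_approxM (@mps_approx1 d) Tf.
by rewrite mul1r.
Qed.

Lemma mps_mulD : left_distributive mps_mul +%R.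
Proof.
move=> f g h; apply: mps_approx_inj => d.
have [[Tf Tg] Th] := (@mps_truncP d f, @mps_truncP d g,
                    @mps_truncP d h).
exists ((mps_trunc d f + mps_trunc d g) * mps_trunc d h).
  exact: mps_approxM (mps_approxD Tf Tg) Th.
by rewrite mulrDl; apply: mps_approxD; exact: mps_approxM.
Qed.

Lemma mps_one_neq0 : mps_one != 0.
Proof.
apply/eqP => /(congr1 (fun f => f 0%MM)) /eqP.
by rewrite /mps_one eqxx oner_eq0.
Qed.

HB.instance Definition _ :=
  GRing.Zmodule_isComNzRing.Build {mps R[n]}
    mps_mulA mps_mulC mps_mul1 mps_mulD mps_one_neq0.

Definition mpsX (a : 'X_{1..n}) : {mps R[n]} := fun m => (m == a)%:R.

Definition supported_in (S : 'X_{1..n} -> Prop) f :=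
  forall m, f m != 0 -> S m.

End PowerSeriesRing.

Arguments mpsX {n} R a.

(* The order is given by its reflexive version [le]; it is unrelated to the
   order that multinomials puts on 'X_{1..n}. *)
Definition monomial_order (n : nat) (le : rel 'X_{1..n}) :=
  [/\ [/\ reflexive le, antisymmetric le, transitive le & total le],
      (forall a b c : 'X_{1..n}, le a b -> le (a + c)%MM (b + c)%MM)
    & (forall a : 'X_{1..n}, le 0%MM a)].

(* N^s x 0^(n-s); variables are indexed from 0. *)
Definition in_scope (n s : nat) (m : 'X_{1..n}) :=
  forall j : 'I_n, (s <= j)%N -> m j = 0%N.

Section InitialMonomial.
Context (n : nat) (R : comNzRingType) (le : rel 'X_{1..n}).
Implicit Types (f u v : {mps R[n]}) (m : 'X_{1..n}).

Definition is_initial_exp f m :=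
  f m != 0 /\ forall m', f m' != 0 -> le m m'.

(* The default value 0 is never relevant when [le] is a monomial order, hence
   a well-order, and [f] is nonzero. *)
Definition initial_exp f : 'X_{1..n} :=
  if pselect (exists m, is_initial_exp f m) is left ex then projT1 (cid ex)
  else 0%MM.

Definition initial f : {mps R[n]} :=
  if f == 0 then 0 else mpsX R (initial_exp f).

(* The order on monomials induced by [le], extended by 0 as largest element. *)
Definition mon_le u v :=
  v = 0 \/ exists a b, [/\ u = mpsX R a, v = mpsX R b & le a b].

(* 0 is neutral for [mon_min], so \big[mon_min/0] is the minimum of the nonzero
   entries, and 0 if there are none. *)
Definition mon_min u v := if `[< mon_le u v >] then u else v.

End InitialMonomial.

Definition echelon_region (n k : nat) (alpha : 'I_k -> 'X_{1..n})
    (s : 'I_k -> nat) (m : 'X_{1..n}) :=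
  exists i : 'I_k, exists2 g : 'X_{1..n},
    in_scope (s i) g & m = (alpha i + g)%MM.

(* Main.v *)
Require Import Defs.
From HB Require Import structures.
From mathcomp Require Import all_boot all_order all_algebra.
From mathcomp Require Import boolp.
From mathcomp Require Import mpoly.

Set Implicit Arguments.
Unset Strict Implicit.
Unset Printing Implicit Defensive.

Import GRing.Theory.
Local Open Scope ring_scope.

(** Write [alpha i] for the exponent of the initial monomial of [f_ i].  If every
    [f_ i] were its initial term alone, the division would be trivial: cut the
    region covered by the translated scopes into disjoint cells, one for each
    [i], let the quotient [a i] collect the part of the series in the [i]-th
    cell, and let the remainder collect what lies outside all cells
    ([cell_decomposition]).  So quotients and remainder are encoded together by
    one series [c], and because [f_ i] is its initial term plus a tail,

      [f = \sum_i a_i * f_i + b]   becomes   [c = f - \sum_i a_i * tail_i],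

    where the [a_i] depend linearly on [c] ([division_exists]).

    Every exponent in the tail of [f_ i] is larger than [alpha i], so the
    coefficient of the right-hand side at [m] involves the coefficients of [c]
    at exponents smaller than [m] only ([cell_quotient_tail_local]).  It
    involves finitely many of them, since [m] has finitely many decompositions
    as a sum.  The system is therefore triangular, and as a monomial order is a
    well-order ([mon_lt_wf]), [c] can be defined by well-founded recursion
    ([wf_fixpoint]).  The recursion is transfinite when exponents have infinitely
    many predecessors, as for a lexicographic order; the finiteness of the sums
    above then takes the place of a convergence argument.

    The condition on initial monomials comes from the disjointness of the cells.
    The initial exponent of [a_i * f_i] is the sum of those of the factors
    ([is_initial_expM]), and it belongs to the [i]-th cell; hence these exponents
    are distinct for distinct [i], and the smallest one survives in the sum
    ([initial_sum_mul]). *)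

(** * Monomial orders are well-orders *)

Definition has_min_if_nonempty (T : Type) (le : rel T) (S : T -> Prop) :=
  (exists x, S x) -> exists2 x, S x & forall y, S y -> le x y.

Section MinUnion.
Context (T : Type) (le : rel T) (le_tr : transitive le) (le_tot : total le).

Lemma has_min_setU (S1 S2 : T -> Prop) :
  has_min_if_nonempty le S1 -> has_min_if_nonempty le S2 ->
  has_min_if_nonempty le (fun x => S1 x \/ S2 x).
Proof.
move=> min1 min2 [x0 S12x0].
case: (pselect (exists x, S1 x)) => [/min1 [x S1x le_x]|no1]; last first.
  have [|y S2y le_y] := min2.
    by case: S12x0 => [S1x0|]; [case: no1|]; exists x0.
  by exists y => [|z [S1z|/le_y//]]; [right | case: no1; exists z].
case: (pselect (exists y, S2 y)) => [/min2 [y S2y le_y]|no2]; last first.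
  by exists x => [|z [/le_x//|S2z]]; [left | case: no2; exists z].
case/orP: (le_tot x y) => [le_xy|le_yx].
  by exists x => [|z [/le_x//|/le_y]]; [left | apply: le_tr].
by exists y => [|z [/le_x|/le_y//]]; [right | apply: le_tr].
Qed.

Lemma has_min_bigcup (I : eqType) (S_ : I -> T -> Prop) (l : seq I) :
  (forall i, i \in l -> has_min_if_nonempty le (S_ i)) ->
  has_min_if_nonempty le (fun x => exists2 i, i \in l & S_ i x).
Proof.
elim: l => [_ [x [//]]|i l IHl minS].
suff -> : (fun x => exists2 j, j \in i :: l & S_ j x) =
          (fun x => S_ i x \/ exists2 j, j \in l & S_ j x).
  apply: has_min_setU; first exact/minS/mem_head.
  by apply: IHl => j jl; apply: minS; rewrite inE jl orbT.
apply/funext => x; apply/propext; split=> [[j]|[Six|[j jl Sjx]]].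
- by rewrite inE => /orP[/eqP->|jl Sjx]; [left | right; exists j].
- by exists i; rewrite ?mem_head.
- by exists j; rewrite // inE jl orbT.
Qed.

End MinUnion.

Section MonomialOrder.
Context (n : nat) (le : rel 'X_{1..n}) (le_mon : monomial_order le).
Implicit Types (a b c m : 'X_{1..n}).

Lemma mon_refl : reflexive le. Proof. by case: le_mon => [[]]. Qed.
Lemma mon_anti : antisymmetric le. Proof. by case: le_mon => [[]]. Qed.
Lemma mon_trans : transitive le. Proof. by case: le_mon => [[]]. Qed.
Lemma mon_total : total le. Proof. by case: le_mon => [[]]. Qed.

Lemma mon_add a b c d : le a b -> le c d -> le (a + c)%MM (b + d)%MM.
Proof.
case: le_mon => _ le_add _ le_ab le_cd.
apply: mon_trans (le_add _ _ c le_ab) _.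
by rewrite ![(b + _)%MM]addmC; apply: le_add.
Qed.

Lemma mon_lepm a b : (a <= b)%MM -> le a b.
Proof.
move=> /submK <-; rewrite -{1}[a]add0m.
by apply: mon_add (mon_refl _); case: le_mon.
Qed.

(** This is the argument behind Dickson's lemma.  Fix [m] in [S].  An element of
    [S] that does not lie above [m] componentwise has a coordinate [i] with a
    value [v < m i]; such elements form finitely many slices of [S], in each of
    which one more coordinate is constant.  Induction on the number of
    coordinates that may vary gives a minimum in each slice, and only finitely
    many candidates remain. *)
Lemma mon_min_exists_slice (r : {set 'I_n}) (S : 'X_{1..n} -> Prop) :
  (forall a b, S a -> S b -> forall i, i \notin r -> a i = b i) ->
  has_min_if_nonempty le S.
Proof.
have [d] := ubnP #|r|; elim: d => // d IHd in r S * => /ltnSE le_rd constS.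
case=> m Sm.
pose slice (iv : option ('I_n * nat)) a :=
  if iv is Some (i, v) then S a /\ a i = v else a = m.
pose l := None :: [seq Some (i, v) | i <- enum 'I_n, v <- iota 0 (m i)].
have lP i v : (Some (i, v) \in l) = (v < m i)%N.
  rewrite inE /=; apply/allpairsPdep/idP => [[j [w [_ + []]]]|lt_v].
    by rewrite mem_iota add0n => + -> ->.
  by exists i, v; rewrite mem_enum mem_iota add0n.
have [||x [iv ivl Sx] min_x] :=
    has_min_bigcup mon_trans mon_total (S_ := slice) (l := l).
- move=> [[i v]|] ivl; last first.
    by move=> _; exists m => // y ->; apply: mon_refl.
  rewrite lP in ivl; case: (boolP (i \in r)) => [ir|ir]; last first.
    by move=> [a [Sa av]]; rewrite -av (constS _ _ Sa Sm _ ir) ltnn in ivl.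
  apply: (IHd (r :\ i)).
    by move: le_rd; rewrite (cardsD1 i r) ir.
  move=> a b [Sa av] [Sb bv] j; rewrite !inE negb_and negbK.
  by case/orP=> [/eqP->|jr]; [rewrite av bv | apply: constS].
- by exists m, None; rewrite ?mem_head.
have Sx' : S x by case: iv Sx {ivl} => [[i v] []|/= ->].
exists x => // y Sy; case: (boolP (m <= y)%MM) => [le_my|].
  apply: mon_trans (mon_lepm le_my); apply: min_x.
  by exists None; rewrite ?mem_head.
rewrite -[(m <= y)%MM]/[forall i, m i <= y i]%N negb_forall => /existsP[i].
rewrite -ltnNge => lt_i; apply: min_x.
by exists (Some (i, y i)); rewrite ?lP.
Qed.

Lemma mon_min_exists (S : 'X_{1..n} -> Prop) : has_min_if_nonempty le S.
Proof. by apply: (@mon_min_exists_slice setT) => a b _ _ i; rewrite inE. Qed.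

Definition mon_lt a b := le a b && (a != b).

Lemma mon_lt_wf : well_founded mon_lt.
Proof.
move=> x; apply: contrapT => nAcc.
have [|m nAcc_m min_m] := @mon_min_exists (fun m => ~ Acc mon_lt m).
  by exists x.
apply: nAcc_m; constructor => y /andP[le_ym neq_ym].
apply: contrapT => /min_m le_my; case/eqP: neq_ym.
by apply: mon_anti; rewrite le_ym le_my.
Qed.

End MonomialOrder.

(** * Triangular systems over a well-founded order *)

(** When [F c m] depends only on the values of [c] below [m], the equation
    [c m = F c m] is a legitimate recursive definition of [c]. *)
Lemma wf_fixpoint (T : Type) (V : zmodType) (lt : T -> T -> Prop)
    (F : (T -> V) -> T -> V) :
  well_founded lt ->
  (forall c d m, (forall m', lt m' m -> c m' = d m') -> F c m = F d m) ->
  exists c, c = F c.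
Proof.
move=> lt_wf Floc.
(* The recursor supplies only the values below [m], while [F] expects a total
   function; by [Floc] the choice of [0] elsewhere does not matter. *)
pose ext m (rec : forall m', lt m' m -> V) m' :=
  if pselect (lt m' m) is left lt_m then rec m' lt_m else 0.
pose c := Fix lt_wf (fun=> V) (fun m rec => F (ext m rec) m).
exists c; apply/funext => m; rewrite {1}/c Fix_eq.
  apply: Floc => m' lt_m'; rewrite /ext.
  by case: pselect.
move=> x g h gh; congr (F _ _); apply/funext => y; rewrite /ext.
by case: pselect.
Qed.

(** * Coefficients and initial monomials of products *)

Section Coefficients.
Context (n : nat) (R : comNzRingType).
Implicit Types (f g : {mps R[n]}) (a b m : 'X_{1..n}).

Lemma mps_coefD f g m : (f + g) m = f m + g m. Proof. by []. Qed.

Lemma mps_coefB f g m : (f - g) m = f m - g m. Proof. by []. Qed.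

Lemma mps_coef_sum (I : Type) (r : seq I) (P : pred I) (F : I -> {mps R[n]}) m :
  (\sum_(i <- r | P i) F i) m = \sum_(i <- r | P i) F i m.
Proof. exact: (big_morph (fun f : {mps R[n]} => f m)). Qed.

Lemma mps_neq0P f : reflect (exists m, f m != 0) (f != 0).
Proof.
apply: (iffP idP) => [f0|[m]]; last by apply: contra_neq => ->.
apply: contrapT => nf; case/eqP: f0; apply/funext => m.
by apply/eqP/negPn/negP => fm; apply: nf; exists m.
Qed.

Lemma mps_coefM_neq0 f g m :
  (f * g) m != 0 -> exists a b, [/\ m = (a + b)%MM, f a != 0 & g b != 0].
Proof.
move=> fg; apply: contrapT => nab; case/eqP: fg.
apply: big1 => -[a b] /= /eqP mab; apply: contrapT => /eqP fagb.
apply: nab; exists a, b; split=> //; apply: contra_neq fagb => ->.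
  by rewrite mul0r.
by rewrite mulr0.
Qed.

(** Isolates the product of the two initial coefficients, and coefficients of
    products with a monomial: there only one decomposition of the exponent
    contributes. *)
Lemma mps_coefM_single f g a b :
  (forall a' b', (a' + b' = a + b)%MM -> f a' != 0 -> g b' != 0 -> a' = a) ->
  (f * g) (a + b)%MM = f a * g b.
Proof.
move=> ab_uniq.
have [da db] : (mdeg a < (mdeg (a + b)%MM).+1)%N /\
               (mdeg b < (mdeg (a + b)%MM).+1)%N.
  by rewrite mdegD !ltnS leq_addr leq_addl.
rewrite -[LHS]/(mps_mul f g (a + b)%MM) /mps_mul.
rewrite (bigD1 (BMultinom da, BMultinom db)) //= big1 ?addr0 //.
move=> -[a' b'] /= /andP[/eqP eq_ab neq_ab]; apply: contrapT => /eqP fagb.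
have eq_a : a' = a :> 'X_{1..n}.
  apply: (ab_uniq _ b') => //; apply: contra_neq fagb => ->.
    by rewrite mul0r.
  by rewrite mulr0.
case/eqP: neq_ab; congr (_, _); apply: val_inj => //=.
by move: eq_ab; rewrite eq_a => /addmI.
Qed.

Lemma eq_mps_coefM f f' g m :
  (forall a b, m = (a + b)%MM -> g b != 0 -> f a = f' a) ->
  (f * g) m = (f' * g) m.
Proof.
move=> ff'; rewrite -[LHS]/(mps_mul f g m) -[RHS]/(mps_mul f' g m).
apply: eq_bigr => -[a b] /= /eqP mab.
by have [->|gb] := eqVneq (g b) 0; rewrite ?mulr0 // (ff' a b).
Qed.

Lemma mpsX_coef_eq a : mpsX R a a = 1.
Proof. by rewrite /mpsX eqxx. Qed.

Lemma mpsX_inj : injective (@mpsX n R).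
Proof.
move=> a b /(congr1 (fun f => f a)); rewrite mpsX_coef_eq /mpsX.
by have [->//|_ /eqP] := eqVneq a b; rewrite oner_eq0.
Qed.

Lemma mpsX_neq0 a : mpsX R a != 0.
Proof. by apply/mps_neq0P; exists a; rewrite mpsX_coef_eq oner_neq0. Qed.

Lemma mpsX_mul a b : mpsX R a * mpsX R b = mpsX R (a + b)%MM.
Proof.
have XE c m : mpsX R c m != 0 -> m = c.
  by rewrite /mpsX; case: (m =P c) => // _; rewrite eqxx.
apply/funext => m; have [->|neq_m] := eqVneq m (a + b)%MM.
  by rewrite mps_coefM_single ?mpsX_coef_eq ?mulr1 // => a' b' _ /XE.
rewrite [RHS]/mpsX (negPf neq_m); apply/eqP/negPn/negP.
move=> /mps_coefM_neq0 [a' [b' [eq_m /XE ea /XE eb]]].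
by rewrite eq_m ea eb eqxx in neq_m.
Qed.

End Coefficients.

Section Initial.
Context (n : nat) (le : rel 'X_{1..n}) (le_mon : monomial_order le).

Lemma is_initial_expP (R : comNzRingType) (f : {mps R[n]}) :
  f != 0 -> is_initial_exp le f (initial_exp le f).
Proof.
move=> /mps_neq0P /(mon_min_exists le_mon) [m fm min_m]; rewrite /initial_exp.
by case: pselect => [ex|[]]; [case: (cid ex) | exists m].
Qed.

Lemma initial_unique (R : comNzRingType) (f : {mps R[n]}) m :
  is_initial_exp le f m -> initial le f = mpsX R m.
Proof.
case=> fm min_m; have f0 : f != 0 by apply/mps_neq0P; exists m.
rewrite /initial (negPf f0); congr mpsX.
have [fe min_e] := is_initial_expP f0.
by apply: (mon_anti le_mon); rewrite min_e ?min_m.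
Qed.

Lemma is_initial_expM (K : fieldType) (f g : {mps K[n]}) a b :
  is_initial_exp le f a -> is_initial_exp le g b ->
  is_initial_exp le (f * g) (a + b)%MM.
Proof.
move=> [fa min_a] [gb min_b]; split; last first.
  move=> m /mps_coefM_neq0 [a' [b' [-> /min_a le_a /min_b le_b]]].
  exact: (mon_add le_mon).
rewrite mps_coefM_single ?mulf_neq0 // => a' b' eq_ab /min_a le_a /min_b le_b.
(* [a <= a'] and [b <= b'] with equal sums force equality. *)
have le_aa : le (a' + b)%MM (a + b)%MM.
  by rewrite -eq_ab; apply: (mon_add le_mon) le_b; apply: mon_refl le_mon _.
apply: (@addIm _ b); apply: (mon_anti le_mon); rewrite le_aa /=.
by apply: (mon_add le_mon) le_a _; apply: mon_refl le_mon _.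
Qed.

(** [mon_min] is neither commutative nor associative on series that are not
    monomials, so the general theory of iterated operators does not apply; a
    lower bound that occurs in the list is followed through the fold. *)
Lemma big_mon_min (R : comNzRingType) (k : nat) (u : 'I_k -> {mps R[n]}) i e :
  u i = mpsX R e -> (forall j, mon_le le (mpsX R e) (u j)) ->
  \big[mon_min le/0]_(j < k) u j = mpsX R e.
Proof.
move=> ui le_u.
have anti v : mon_le le (mpsX R e) v -> mon_le le v (mpsX R e) -> v = mpsX R e.
  have X0 c : (mpsX R c == 0) = false by rewrite (negPf (mpsX_neq0 R c)).
  case=> [->|[a [b [/mpsX_inj <- -> le_eb]]]] [/eqP|]; rewrite ?X0 //.
    by case=> a [b [/esym/eqP]]; rewrite X0.
  case=> a' [b' [/mpsX_inj <- /mpsX_inj <- le_be]]; congr mpsX.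
  by apply: (mon_anti le_mon); rewrite le_be.
have /(_ (index_enum 'I_k)) : forall r : seq 'I_k,
    mon_le le (mpsX R e) (\big[mon_min le/0]_(j <- r) u j) /\
    (i \in r -> \big[mon_min le/0]_(j <- r) u j = mpsX R e).
  elim=> [|j r [le_r eq_r]]; first by rewrite big_nil; split=> //; left.
  rewrite big_cons /mon_min; split; first by case: asboolP.
  rewrite inE => /orP[/eqP <-|/eq_r ->]; case: asboolP => //.
    by rewrite ui.
  by move=> /anti ->.
by case=> _; apply; apply: mem_index_enum.
Qed.

(** Since the initial exponents of the products are pairwise distinct, the
    smallest of them occurs in one product only, so it cannot cancel. *)
Lemma initial_sum_mul (K : fieldType) (k : nat) (a f : 'I_k -> {mps K[n]}) :
  (forall i, f i != 0) ->
  (forall i j, a i != 0 -> a j != 0 ->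
     (initial_exp le (a i) + initial_exp le (f i) =
      initial_exp le (a j) + initial_exp le (f j))%MM -> i = j) ->
  initial le (\sum_(i < k) a i * f i) =
  \big[mon_min le/0]_(i < k) (initial le (a i) * initial le (f i)).
Proof.
move=> f0 e_inj; pose e i := (initial_exp le (a i) + initial_exp le (f i))%MM.
have prodE i : initial le (a i) * initial le (f i) =
    if a i == 0 then 0 else mpsX K (e i).
  rewrite /initial (negPf (f0 i)); case: ifP => _; first exact: mul0r.
  exact: mpsX_mul.
have eP i : a i != 0 -> is_initial_exp le (a i * f i) (e i).
  by move=> ai; apply: is_initial_expM; apply: is_initial_expP.
have termP i m : (a i * f i) m != 0 -> a i != 0 /\ le (e i) m.
  have [->|ai] := eqVneq (a i) 0; first by rewrite mul0r eqxx.
  by case: (eP i ai) => _ min_e /min_e.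
case: (pselect (exists i, a i != 0)) => [[i0 ai0]|all0]; last first.
  have a0 i : a i = 0 by apply/eqP/negPn/negP => ai; apply: all0; exists i.
  rewrite big1 => [|i _]; last by rewrite a0 mul0r.
  rewrite /initial eqxx; elim/big_ind: _ => // [u v <- <-|i _].
    by rewrite /mon_min; case: asboolP.
  by rewrite a0 eqxx mul0r.
have [|_ [i ai ->] min_e] :=
    mon_min_exists le_mon (S := fun m => exists2 i, a i != 0 & m = e i).
  by exists (e i0), i0.
rewrite (big_mon_min (i := i) (e := e i)); last 2 first.
- by rewrite prodE (negPf ai).
- move=> j; rewrite prodE; case: eqVneq => [_|aj]; first by left.
  by right; exists (e i), (e j); split=> //; apply: min_e; exists j.
apply: initial_unique; split=> [|m]; rewrite mps_coef_sum.
  rewrite (bigD1 i) //= big1 ?addr0; first by case: (eP i ai).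
  move=> j neq_ji; apply/eqP/negPn/negP => /termP [aj le_ej].
  case/eqP: neq_ji; apply: e_inj => //; apply: (mon_anti le_mon).
  by rewrite le_ej min_e //; exists j.
move=> sum_neq0; have [j /termP [aj le_ej]] : exists j, (a j * f j) m != 0.
  apply: contrapT => no_j; case/eqP: sum_neq0; apply: big1 => j _.
  by apply/eqP/negPn/negP => ajfj; apply: no_j; exists j.
by apply: mon_trans le_ej => //; apply: min_e; exists j.
Qed.

End Initial.

(** * Division *)

Section Division.
Context (K : fieldType) (n k : nat) (f_ : 'I_k -> {mps K[n]}).
Context (s : 'I_k -> nat) (le : rel 'X_{1..n}).
Context (f_neq0 : forall i, f_ i != 0) (le_mon : monomial_order le).

Local Notation alpha i := (initial_exp le (f_ i)).

(** The translated sets [alpha i + N^(s i)] may overlap.  Choosing one index for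
    each exponent of their union cuts it into disjoint cells, so that every
    series [c] becomes the data of exactly one family of quotients (read off from
    the cells) and one remainder (read off from the complement). *)
Definition cell m : option 'I_k :=
  [pick i | `[< exists2 g, in_scope (s i) g & m = (alpha i + g)%MM >]].

Lemma cell_some m i :
  cell m = Some i -> exists2 g, in_scope (s i) g & m = (alpha i + g)%MM.
Proof. by rewrite /cell; case: pickP => // j /asboolP + [<-]. Qed.

Lemma cell_none m : cell m = None -> ~ echelon_region (fun i => alpha i) s m.
Proof.
by rewrite /cell; case: pickP => // no_i _ [i /asboolP]; rewrite no_i.
Qed.

(** The division by the leading coefficient makes multiplication by the initial
    term of [f_ i] give back [c] on the [i]-th cell. *)
Definition cell_quotient (c : {mps K[n]}) i : {mps K[n]} := fun g =>
  if cell (alpha i + g)%MM == Some i then c (alpha i + g)%MM / f_ i (alpha i)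
  else 0.

Definition cell_remainder (c : {mps K[n]}) : {mps K[n]} := fun m =>
  if cell m is None then c m else 0.

Definition lead_part i : {mps K[n]} := fun m =>
  if m == alpha i then f_ i m else 0.

Definition tail_part i : {mps K[n]} := fun m =>
  if m == alpha i then 0 else f_ i m.

Lemma lead_tail i : f_ i = lead_part i + tail_part i.
Proof.
apply/funext => m; rewrite mps_coefD /lead_part /tail_part.
by case: eqP => _; rewrite ?addr0 ?add0r.
Qed.

Lemma lead_part_neq0 i m : lead_part i m != 0 -> m = alpha i.
Proof. by rewrite /lead_part; case: (m =P _) => // _; rewrite eqxx. Qed.

Lemma cell_quotient_neq0 c i g :
  cell_quotient c i g != 0 -> cell (alpha i + g)%MM = Some i.
Proof. by rewrite /cell_quotient; case: (cell _ =P _) => // _; rewrite eqxx. Qed.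

Lemma cell_quotient_scope c i :
  supported_in (in_scope (s i)) (cell_quotient c i).
Proof. by move=> g /cell_quotient_neq0 /cell_some [h hs /addmI ->]. Qed.

Lemma cell_remainder_region c :
  supported_in (fun m => ~ echelon_region (fun i => alpha i) s m)
    (cell_remainder c).
Proof.
move=> m; rewrite /cell_remainder; case eq_cell: (cell m) => [i|].
  by rewrite eqxx.
by move=> _; apply: cell_none.
Qed.

Lemma coef_cell_quotient_lead c i m :
  (cell_quotient c i * lead_part i) m = if cell m == Some i then c m else 0.
Proof.
case: eqP => [cell_m|neq_cell].
  have [g _ def_m] := cell_some cell_m.
  have [fi _] := is_initial_expP le_mon (f_neq0 i).
  rewrite def_m addmC mps_coefM_single => [|g' b' eq_m _ /lead_part_neq0 eq_b].
    rewrite /cell_quotient /lead_part eqxx [(g + _)%MM]addmC -def_m cell_m eqxx.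
    by rewrite divfK.
  by move: eq_m; rewrite eq_b => /addIm.
apply/eqP/negPn/negP => /mps_coefM_neq0.
move=> [g [b [def_m /cell_quotient_neq0 cell_g /lead_part_neq0 eq_b]]].
by apply: neq_cell; rewrite def_m eq_b addmC.
Qed.

(** Division by the initial terms alone: the cells and the complement of their
    union partition all the exponents. *)
Lemma cell_decomposition c :
  \sum_(i < k) cell_quotient c i * lead_part i + cell_remainder c = c.
Proof.
apply/funext => m; rewrite mps_coefD mps_coef_sum /cell_remainder.
under eq_bigr do rewrite coef_cell_quotient_lead.
case eq_cell: (cell m) => [i|]; last by rewrite big1 ?add0r.
rewrite (bigD1 i) //= eqxx big1 ?addr0 // => j neq_ji.
by rewrite eq_sym; case: eqP => // -[eq_ij]; rewrite eq_ij eqxx in neq_ji.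
Qed.

(** The system is triangular: an exponent [b] of the tail of [f_ i] exceeds
    [alpha i], so the coefficient of [c] that meets it in the exponent [g + b]
    is the one at [alpha i + g], which is smaller. *)
Lemma cell_quotient_tail_local c d i m :
  (forall m', mon_lt le m' m -> c m' = d m') ->
  (cell_quotient c i * tail_part i) m = (cell_quotient d i * tail_part i) m.
Proof.
move=> eq_cd; apply: eq_mps_coefM => g b def_m; rewrite {m}def_m in eq_cd *.
rewrite /tail_part; case: (b =P _) => [_|/eqP neq_b fb]; first by rewrite eqxx.
rewrite /cell_quotient eq_cd //.
have [_ /(_ _ fb) le_b] := is_initial_expP le_mon (f_neq0 i).
rewrite /mon_lt [(g + b)%MM]addmC; apply/andP; split.
  exact: mon_add le_b (mon_refl le_mon g).
by apply: contra_neq neq_b => /addIm.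
Qed.

(** Splitting each [f_ i] into initial term and tail and applying
    [cell_decomposition] turns the division into the fixed-point equation
    [c = f - \sum_i cell_quotient c i * tail_part i]. *)
Lemma division_exists f :
  exists c, f = \sum_(i < k) cell_quotient c i * f_ i + cell_remainder c.
Proof.
have [|c eq_c] := wf_fixpoint (V := K)
  (F := fun c => f - \sum_(i < k) cell_quotient c i * tail_part i)
  (mon_lt_wf le_mon).
  move=> c d m eq_cd; rewrite !mps_coefB !mps_coef_sum; congr (_ - _).
  by apply: eq_bigr => i _; apply: cell_quotient_tail_local.
exists c; under eq_bigr do rewrite lead_tail mulrDr.
by rewrite big_split /= addrAC cell_decomposition {1}eq_c subrK.
Qed.

(** The two sums lie in the [i]-th and the [j]-th cell, which are disjoint. *)
Lemma cell_quotient_initial_inj c i j :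
  cell_quotient c i != 0 -> cell_quotient c j != 0 ->
  (initial_exp le (cell_quotient c i) + alpha i =
   initial_exp le (cell_quotient c j) + alpha j)%MM -> i = j.
Proof.
move=> /(is_initial_expP le_mon) [/cell_quotient_neq0 cell_i _].
move=> /(is_initial_expP le_mon) [/cell_quotient_neq0 cell_j _] eq_e.
by apply: Some_inj; rewrite -cell_i -cell_j ![(alpha _ + _)%MM]addmC eq_e.
Qed.

End Division.

Theorem theorem1 (K : fieldType) (n k : nat)
    (f_ : 'I_k -> {mps K[n]}) (s : 'I_k -> nat) (le : rel 'X_{1..n})
    (f_neq0 : forall i, f_ i != 0)
    (s_le : forall i, (s i <= n)%N)
    (le_mon : monomial_order le) :
  let A := echelon_region (fun i => initial_exp le (f_ i)) s in
  let B := fun m => ~ A m in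
  forall f : {mps K[n]},
  exists (a : 'I_k -> {mps K[n]}) (b : {mps K[n]}),
    [/\ forall i, supported_in (in_scope (s i)) (a i),
        supported_in B b,
        f = \sum_(i < k) a i * f_ i + b
      & initial le (f - b) =
        \big[mon_min le/0]_(i < k) (initial le (a i) * initial le (f_ i))].
Proof.
move=> A B f; have [c def_f] := division_exists s f_neq0 le_mon f.
exists (cell_quotient f_ s le c), (cell_remainder f_ s le c); split=> //.
- exact: cell_quotient_scope.
- exact: cell_remainder_region.
rewrite {1}def_f addrK; apply: initial_sum_mul => // i j.
exact: cell_quotient_initial_inj.
Qed.
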